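(* Let $n\ge3$ and $\delta\in[0,1)$. If a distribution over permutations of $[n]$ satisfies the $(3,\delta)$-uniform-induced-ordering property, then there is an algorithm for the secretary problem that, for every assignment of distinct values to the items, selects the item of maximum value with probability at least $\frac{(1-\delta)^2}{6(1+\delta)}$.
   Context: $(k,\delta)$-uniform-induced-ordering property of a distribution over permutations $\pi$ of $[n]$ ($\pi(i)$ is the arrival time of item $i$): for every $k$ distinct items $y_1,\dots,y_k$, $\Pr[\pi(y_1)<\dots<\pi(y_k)]\ge(1-\delta)/k!$. Secretary problem: an adversary assigns distinct values to items $[n]$; items arrive in the order $\pi$ drawn from the distribution, independently of the values; an online comparison-based (possibly randomized) algorithm irrevocably decides at each arrival whether to select the current item (at most one selection), based only on the relative order of values seen so far; it succeeds if it selects the maximum-value item. *)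

(* Defs.v *)
From HB Require Import structures.
From mathcomp Require Import all_boot all_order all_algebra all_fingroup.
From mathcomp Require Import reals.
Set Implicit Arguments.
Unset Strict Implicit.
Unset Printing Implicit Defensive.
Import Order.TTheory GRing.Theory Num.Theory.
Local Open Scope ring_scope.

Record fdist (R : realType) (T : finType) := FDist {
  fdist_mass :> {ffun T -> R};
  fdist_ge0 : forall x, 0 <= fdist_mass x;
  fdist_sum1 : \sum_x fdist_mass x = 1 }.

Definition Pr (R : realType) (T : finType) (d : fdist R T) (E : pred T) : R :=
  \sum_(x | E x) d x.

(* p i is the arrival time of item i, so (p^-1)%g t is the item arriving at
   time t. *)
Definition uniform_induced_ordering (R : realType) (n k : nat) (delta : R)
    (mu : fdist R 'S_n) : Prop :=
  forall y : k.-tuple 'I_n, uniq y ->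
    (1 - delta) / k`!%:R
      <= Pr mu (fun p => sorted ltn [seq nat_of_ord (p i) | i <- y]).

(* The relative order of the values seen up to time t: the pairs (s, s') of
   times at most t such that the item arriving at s has a smaller value than
   the item arriving at s'. *)
Definition relative_order (R : realType) (n : nat) (v : 'I_n -> R) (p : 'S_n)
    (t : 'I_n) : {set 'I_n * 'I_n} :=
  [set s : 'I_n * 'I_n | [&& (s.1 <= t)%N, (s.2 <= t)%N &
     v ((p^-1)%g s.1) < v ((p^-1)%g s.2)]].

(* Given the current time and the relative order seen so far, says whether to
   select the current item, provided that none has been selected before. *)
Definition stopping_rule (n : nat) := 'I_n -> {set 'I_n * 'I_n} -> bool.

(* The whole random seed is drawn at the start, independently of the arrival
   order. A finite seed loses no generality, since there are finitely many
   stopping rules. *)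
Record secretary_algorithm (R : realType) (n : nat) := SecretaryAlgorithm {
  seed : finType;
  seed_dist : fdist R seed;
  rule : seed -> stopping_rule n }.

Definition selects (R : realType) (n : nat) (A : stopping_rule n)
    (v : 'I_n -> R) (p : 'S_n) (i : 'I_n) : bool :=
  A (p i) (relative_order v p (p i)) &&
  [forall s : 'I_n, (s < p i)%N ==> ~~ A s (relative_order v p s)].

Definition succeeds (R : realType) (n : nat) (A : stopping_rule n)
    (v : 'I_n -> R) (p : 'S_n) : bool :=
  [exists i, selects A v p i && [forall j, v j <= v i]].

Definition success_probability (R : realType) (n : nat) (mu : fdist R 'S_n)
    (A : secretary_algorithm R n) (v : 'I_n -> R) : R :=
  \sum_(w : seed A) seed_dist A w * Pr mu (succeeds (rule w) v).

(* Main.v *)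
Require Import Defs.
From HB Require Import structures.
From mathcomp Require Import all_boot all_order all_algebra all_fingroup.
From mathcomp Require Import reals.
From mathcomp Require Import lra.
Set Implicit Arguments.
Unset Strict Implicit.
Unset Printing Implicit Defensive.
Import Order.TTheory GRing.Theory Num.Theory.
Local Open Scope ring_scope.

(** Draw a threshold time [w] uniformly and select the first record arriving at
    time [w] or later.  If the second best item [b] arrives before [w] and the
    best item [a] does not, then [a] is selected.  The item [z] arriving at time
    [w] turns "[b] before [w], [a] not before [w]" into the induced ordering
    [b, z, a], so that summing over [w] amounts to summing over items [z].  Each
    [z] other than [a] and [b] contributes at least [(1 - delta) / 6], and [z = a]
    contributes at least twice that, which makes up for [z = b].  This gives the
    stronger bound [(1 - delta) / 6]. *)

Section FiniteDistributions.
Variables (R : realType) (T : finType).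
Implicit Types (mu : fdist R T) (E F : pred T).

Lemma Pr_sub mu E F : subpred E F -> Pr mu E <= Pr mu F.
Proof.
move=> sEF; rewrite /Pr [leLHS]big_mkcond [leRHS]big_mkcond /=.
apply: ler_sum => x _; case: ifP => [/sEF -> //|_].
by case: ifP => // _; exact: fdist_ge0.
Qed.

Lemma Pr_predU mu E F : (forall x, E x -> ~~ F x) ->
  Pr mu (predU E F) = Pr mu E + Pr mu F.
Proof.
move=> dEF; rewrite /Pr (bigID E) /=; congr (_ + _); apply: eq_bigl => x.
  by case: (E x); rewrite /= ?andbF.
by move: (dEF x); case: (E x) => /=; [move=> /(_ isT)/negbTE -> | rewrite andbT].
Qed.

Lemma fdist_uniform_subproof (t0 : T) : \sum_x [ffun _ : T => #|T|%:R^-1 : R] x = 1.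
Proof.
under eq_bigr do rewrite ffunE.
rewrite sumr_const -[_ *+ _]mulr_natr mulVf // pnatr_eq0 -lt0n.
by apply/card_gt0P; exists t0.
Qed.

Lemma fdist_uniform_ge0 (x : T) : 0 <= [ffun _ : T => #|T|%:R^-1 : R] x.
Proof. by rewrite ffunE invr_ge0 ler0n. Qed.

(** The point [t0] witnesses that [T] is nonempty, so that the masses sum to 1. *)
Definition fdist_uniform (t0 : T) : fdist R T :=
  FDist fdist_uniform_ge0 (fdist_uniform_subproof t0).

End FiniteDistributions.

Lemma exists_two_best (R : realType) (n : nat) (v : 'I_n -> R) :
  (2 <= n)%N -> injective v ->
  exists a b : 'I_n, [/\ a != b, forall j, v j <= v a &
    forall j, j != a -> v j <= v b].
Proof.
case: n v => [|[|n]] // v _ inj_v.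
case: (@arg_maxP _ _ _ ord0 xpredT v isT) => a _ maxa.
(* The second maximisation, over the items other than [a], needs a point to start from. *)
have [c ca] : exists c, c != a.
  exists (if a == ord0 then ord_max else ord0).
  by case: (eqVneq a ord0) => [->|]; rewrite // eq_sym.
case: (@arg_maxP _ _ _ c (predC1 a) v ca) => b /= ba maxb.
exists a, b; split=> [|j|j ja]; [by rewrite eq_sym | exact: maxa | exact: maxb].
Qed.

(** The quantified clause makes the current item a record; that only the first record from [w] on is
    taken is enforced by [selects]. *)
Definition threshold_rule (n : nat) (w : 'I_n) : stopping_rule n :=
  fun t S => (w <= t)%N && [forall s : 'I_n, (s < t)%N ==> ((s, t) \in S)].

(** Item [a] is a record whenever it arrives. An item arriving from time [w] on but before [a] is
    preceded by [b], which is at least as good, so it is not a record. *)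
Lemma threshold_rule_succeeds (R : realType) (n : nat) (v : 'I_n -> R)
    (a b w : 'I_n) (p : 'S_n) : injective v ->
  (forall j, v j <= v a) -> (forall j, j != a -> v j <= v b) ->
  (p b < w <= p a)%N -> succeeds (threshold_rule w) v p.
Proof.
move=> inj_v maxa maxb /andP[bw wa]; apply/existsP; exists a.
apply/andP; split; last by apply/forallP.
apply/andP; split.
  rewrite /threshold_rule wa; apply/forallP => s; apply/implyP => sa.
  rewrite inE /= leqnn (ltnW sa) permK /= lt_neqAle maxa andbT.
  apply/negP => /eqP/inj_v sE; move: sa.
  by rewrite -sE permKV ltnn.
apply/forallP => s; apply/implyP => sa; rewrite negb_and.
case: (leqP w s) => //= ws; apply/forallPn; exists (p b).
rewrite negb_imply (leq_trans bw ws) inE /= permK !negb_and -leNgt.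
rewrite maxb ?orbT //.
by apply/negP => /eqP sE; move: sa; rewrite -sE permKV ltnn.
Qed.

(** For each fixed [p], the map from [z] to [p z] is a bijection from items to times. *)
Lemma sum_Pr_time (R : realType) (n : nat) (mu : fdist R 'S_n)
    (E : 'S_n -> 'I_n -> bool) :
  \sum_w Pr mu (E^~ w) = \sum_z Pr mu (fun p => E p (p z)).
Proof.
rewrite /Pr (exchange_big_dep xpredT) //= [RHS](exchange_big_dep xpredT) //=.
by apply: eq_bigr => p _; rewrite (reindex_inj (@perm_inj _ p)).
Qed.

Section ThreeItems.
Variables (R : realType) (n : nat) (delta : R) (mu : fdist R 'S_n).
Hypothesis hmu : uniform_induced_ordering 3 delta mu.

Lemma Pr_induced_order3 (x y z : 'I_n) : x != y -> y != z -> x != z ->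
  (1 - delta) / 6%:R <= Pr mu (fun p => (p x < p y < p z)%N).
Proof.
move=> xy yz xz; have := @hmu [tuple x; y; z].
rewrite /= !inE negb_or xy yz xz => /(_ isT) /le_trans; apply.
by apply: Pr_sub => p /=; rewrite andbT.
Qed.

(** A third item [z] exists, and the orders [x, z, y] and [x, y, z] are disjoint events, each
    putting [x] before [y]. *)
Lemma Pr_induced_order2 (x y : 'I_n) : (3 <= n)%N -> x != y ->
  (1 - delta) / 6%:R + (1 - delta) / 6%:R <= Pr mu (fun p => (p x < p y)%N).
Proof.
move=> hn xy.
have [z] : exists z, z \notin [set x; y].
  apply/existsP; rewrite -negb_forall; apply/negP => /forallP all2.
  have /subset_leq_card : [set: 'I_n] \subset [set x; y].
    by apply/subsetP => z _; exact: all2.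
  by rewrite cardsT card_ord cards2 xy leqNgt hn.
rewrite !inE negb_or => /andP[zx zy].
apply: le_trans (lerD (@Pr_induced_order3 x z y _ _ _)
  (@Pr_induced_order3 x y z _ _ _)) _; rewrite // 1?eq_sym //.
rewrite -Pr_predU => [|p /andP[_ zy']]; last first.
  by rewrite negb_and -!leqNgt (ltnW zy') orbT.
by apply: Pr_sub => p /= /orP[/andP[/ltn_trans]|/andP[]//]; apply.
Qed.

Lemma sum_Pr_between (a b : 'I_n) : (3 <= n)%N -> a != b ->
  n%:R * ((1 - delta) / 6%:R) <= \sum_z Pr mu (fun p => (p b < p z <= p a)%N).
Proof.
move=> hn ab; set c := (1 - delta) / 6%:R.
have -> : n%:R * c = \sum_(z : 'I_n) c by rewrite sumr_const card_ord mulr_natl.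
rewrite (bigD1 a) //= (bigD1 b) 1?eq_sym //= addrA.
rewrite [leRHS](bigD1 a) //= [X in _ <= _ + X](bigD1 b) 1?eq_sym //= [leRHS]addrA.
(* The term [z = a] pays for both copies of [c], its event being that [b] precedes [a]; the term
   [z = b] is only bounded below by 0. *)
apply: lerD.
  rewrite -[leLHS]addr0; apply: lerD.
    apply: le_trans (Pr_induced_order2 hn (_ : b != a)) _; first by rewrite eq_sym.
    by apply: Pr_sub => p; rewrite leqnn andbT.
  by apply: sumr_ge0 => p _; exact: fdist_ge0.
apply: ler_sum => z /andP[za zb].
apply: le_trans (@Pr_induced_order3 b z a _ _ _) _; rewrite // 1?eq_sym //.
by apply: Pr_sub => p /andP[-> /ltnW].
Qed.

End ThreeItems.

Theorem mainTheorem17 (R : realType) (n : nat) (hn : (3 <= n)%N) (delta : R)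
    (hdelta0 : 0 <= delta) (hdelta1 : delta < 1) (mu : fdist R 'S_n)
    (hmu : uniform_induced_ordering 3 delta mu) :
  exists A : secretary_algorithm R n,
    forall v : 'I_n -> R, injective v ->
      (1 - delta) ^+ 2 / (6%:R * (1 + delta)) <= success_probability mu A v.
Proof.
have n_gt0 : (0 < n)%N by apply: leq_trans hn.
exists (SecretaryAlgorithm (fdist_uniform R (Ordinal n_gt0)) (@threshold_rule n)).
move=> v inj_v; have [a [b [ab maxa maxb]]] := exists_two_best (ltnW hn) inj_v.
have nR_gt0 : 0 < n%:R :> R by rewrite ltr0n.
(* The stated bound is this one times [(1 - delta) / (1 + delta)], which is at most 1. *)
apply: (@le_trans _ _ ((1 - delta) / 6%:R)).
  rewrite ler_pdivrMr ?mulr_gt0 //; last by lra.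
  nra.
rewrite /success_probability /=.
under eq_bigr do rewrite ffunE card_ord.
rewrite -mulr_sumr [leRHS]mulrC ler_pdivlMr // mulrC.
apply: le_trans (sum_Pr_between hmu hn ab) _.
(* Return from items [z] to thresholds [w], to compare the two sums term by term. *)
rewrite -(sum_Pr_time mu (fun p w => (p b < w <= p a)%N)).
apply: ler_sum => w _; apply: Pr_sub => p.
exact: threshold_rule_succeeds.
Qed.
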